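(* Let $\mathbf{A} \in \mathbb{R}^{M \times N}$, $\boldsymbol{\Psi} \in \mathbb{R}^{K \times N}$, $\mu > 0$, and let $\mathbf{W} = \operatorname{diag}(\mathbf{w})$, where $\mathbf{w} \in \mathbb{R}^K$ has strictly positive entries. Let $\mathbf{Q}^{\text{st}}_{\mu} = \mathbf{A}^T \mathbf{A} + \mu \boldsymbol{\Psi}^T \mathbf{W}^2 \boldsymbol{\Psi}$ and $R = \operatorname{rank}(\boldsymbol{\Psi})$. Then the first $R$ largest eigenvalues of $\mathbf{Q}^{\text{st}}_{\mu}$ satisfy $$\lambda_N(\mathbf{A}^T \mathbf{A}) + \mu \lambda_{R}(\boldsymbol{\Psi}^T \boldsymbol{\Psi})\, \lambda_{i+(N-R)}(\mathbf{W}^2) \leq \lambda_i( \mathbf{Q}^{\text{st}}_{\mu} ) \leq \lambda_1(\mathbf{A}^T \mathbf{A}) + \mu \lambda_1( \boldsymbol{\Psi}^T \boldsymbol{\Psi})\, \lambda_i(\mathbf{W}^2)$$ for $i = 1, \ldots, R$, and the remaining $N-R$ eigenvalues satisfy $$\lambda_N(\mathbf{A}^T \mathbf{A}) \leq \lambda_i(\mathbf{Q}^{\text{st}}_{\mu}) \leq \lambda_1(\mathbf{A}^T \mathbf{A}) + \mu \lambda_1(\boldsymbol{\Psi}^T \boldsymbol{\Psi})\, \lambda_i(\mathbf{W}^2)$$ for $i = R+1, \ldots, N$.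
   Context: For a square matrix $\mathbf{X}$, $\lambda_i(\mathbf{X})$ denotes the $i$th largest eigenvalue of $\mathbf{X}$ in descending order, counting multiplicities. Here $\mathbf{A}$ is the forward operator of a linear inverse problem, $\boldsymbol{\Psi}$ is a (possibly rank-deficient) sparsifying transform, $\mathbf{w}$ is a vector of weights, and $\mu$ is a regularization parameter; $\mathbf{Q}^{\text{st}}_{\mu}$ is the normal-equations matrix of the least squares problem of minimizing $\| \mathbf{A}\mathbf{x} - \mathbf{b} \|_2^2 + \mu \| \mathbf{W} \boldsymbol{\Psi} \mathbf{x} \|_2^2$ over $\mathbf{x} \in \mathbb{R}^N$, where $\mathbf{b} \in \mathbb{R}^M$ is the data vector.
   Formalization: The first lower bound with index i+(N-R) is false when K > N, so it is proved only for K ≤ N; for every K it is proved with index i+(K-R) instead; eigenvalues of W² with index beyond K, undefined in the text, are read as 0. *)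

(* Defs.v *)
From mathcomp Require Import all_boot all_order all_algebra.
From mathcomp Require Import polyrcf.
From mathcomp Require Export reals.

Set Implicit Arguments.
Unset Strict Implicit.
Unset Printing Implicit Defensive.

Import Order.TTheory GRing.Theory Num.Theory.
Local Open Scope ring_scope.

(* The real roots of the characteristic polynomial, in descending order and
   repeated according to multiplicity ([rootsR] lists the distinct real roots
   of a nonzero polynomial in increasing order). *)
Definition eigenvals (R : rcfType) (n : nat) (X : 'M[R]_n) : seq R :=
  flatten [seq nseq (mup x (char_poly X)) x | x <- rev (rootsR (char_poly X))].

(* The index is 1-based: [lambda 1 X] is the largest eigenvalue.  An index
   larger than the number of eigenvalues gives 0. *)
Definition lambda (R : rcfType) (n : nat) (i : nat) (X : 'M[R]_n) : R :=
  nth 0 (eigenvals X) i.-1.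

Definition Qst (R : rcfType) (M N K : nat) (A : 'M[R]_(M, N))
    (Psi : 'M[R]_(K, N)) (mu : R) (w : 'rV[R]_K) : 'M[R]_N :=
  let W := diag_mx w in
  A^T *m A + mu *: (Psi^T *m (W *m W) *m Psi).

(* When the characteristic polynomial splits over R, [eigenvals] is the list
   of all its roots in descending order. *)
Lemma eigenvals_split (R : rcfType) (n : nat) (X : 'M[R]_n) (s : seq R) :
  char_poly X = \prod_(x <- s) ('X - x%:P) -> sorted >=%R s ->
  eigenvals X = s.
Proof.
move=> Xs s_sorted.
have X0 : char_poly X != 0 by rewrite monic_neq0 ?char_poly_monic.
have mem_roots y : (y \in rootsR (char_poly X)) = (y \in s).
  have := roots_on_rootsR X0 y; rewrite in_itv /= => <-.
  by rewrite Xs root_prod_XsubC.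
have roots_lt : sorted >%R (rev (rootsR (char_poly X))).
  by rewrite rev_sorted; apply: sorted_roots.
apply: (sorted_eq (leT := >=%R)) => //.
- by move=> x y z /= xy yz; apply: le_trans yz xy.
- by move=> x y /= /andP[xy yx]; apply: le_anti; rewrite xy yx.
- rewrite /eigenvals; elim: (rev _) roots_lt => //= x t IHt.
  rewrite (path_sortedE (leT := >%R)); last by move=> ? ? ? /= /[swap]; apply: lt_trans.
  case/andP=> /allP xt /IHt.
  have ge_tr : transitive (>=%R : rel R).
    by move=> a b c /= ab bc; apply: le_trans bc ab.
  rewrite !(sorted_pairwise ge_tr) => t_sorted.
  rewrite pairwise_cat t_sorted andbT; apply/andP; split.
    apply/allrelP => a b /nseqP[-> _] /flatten_mapP[c ct /nseqP[-> _]] /=.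
    by apply/ltW/xt.
  elim: (mup x _) => //= k ->; rewrite andbT.
  by apply/allP => a /nseqP[-> _] /=.
- apply/allP => y _ /=; apply/eqP.
  rewrite /eigenvals count_flatten -map_comp.
  rewrite -(mu_prod_XsubC y s) -Xs.
  have uR : uniq (rev (rootsR (char_poly X))).
    by rewrite rev_uniq; apply: uniq_roots.
  have count_roots : forall t : seq R, uniq t ->
    sumn [seq (count_mem y \o (fun x => nseq (mup x (char_poly X)) x)) x | x <- t]
    = if y \in t then mup y (char_poly X) else 0%N.
    elim=> //= x t IHt /andP[xt ut]; rewrite IHt // count_nseq /= inE eq_sym.
    have [yx|] := eqVneq x y; last by rewrite mul0n.
    by rewrite yx mul1n -yx (negbTE xt) addn0.
  rewrite count_roots // mem_rev mem_roots; case: ifP => // /negbT ys.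
  by rewrite mupNroot // Xs root_prod_XsubC.
Qed.

(* Main.v *)
Require Import Defs.
From mathcomp Require Import all_boot all_order all_algebra.
From mathcomp Require Import reals complex.
From mathcomp Require Import ring.
Set Implicit Arguments.
Unset Strict Implicit.
Unset Printing Implicit Defensive.

Import Order.TTheory GRing.Theory Num.Theory.
Local Open Scope ring_scope.

(** A real symmetric matrix [X] of size [n] is orthogonally diagonalizable.
    Hence for [1 <= i <= n] there is a subspace of dimension at least [i] on which the
    quadratic form of [X] is at least [lambda i X] times the squared norm
    ([top_eigenspace]), and one of dimension more than [n - i] on which it is
    at most that ([bottom_eigenspace]).  Two subspaces whose dimensions add up
    to more than [n] share a nonzero vector, so conversely a bound of the
    quadratic form on any subspace of the right dimension bounds an eigenvalue
    ([lambda_ge], [lambda_le]): this is the Courant-Fischer principle.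

    The eigenvalues of [Q] are then bounded by producing such subspaces.  The
    form of [Q] at [u] is that of [A^T A] at [u], which lies between its
    extreme eigenvalues everywhere, plus [mu] times the form of [W^2] at
    [Psi u].  For the upper bound take the vectors that [Psi] sends into the
    bottom eigenspace of [W^2] ([congruence_bottom]): there

      [<W^2 Psi u, Psi u> <= lambda i (W^2) |Psi u|^2
                          <= lambda i (W^2) lambda 1 (Psi^T Psi) |u|^2].

    For the lower bound take, inside an [r]-dimensional top eigenspace of
    [Psi^T Psi], the vectors that [Psi] sends into the top eigenspace of [W^2]
    of dimension [i + (K - r)] ([congruence_top]).  Landing in that space costs
    [K - (i + (K - r)) = r - i] linear conditions, which leaves dimension [i].
    The lower bound with [N - r] in place of [K - r] is weaker when [K <= N],
    since the eigenvalues of [W^2] decrease and stay nonnegative.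

    Vectors are rows here, so that [Psi u] is written [u *m Psi^T]. *)

(** * Squared norms and quadratic forms *)

Definition sqnorm (R : rcfType) n (u : 'rV[R]_n) : R := (u *m u^T) 0 0.
Definition qform (R : rcfType) n (X : 'M[R]_n) (u : 'rV[R]_n) : R :=
  (u *m X *m u^T) 0 0.

Lemma sqnormE (R : rcfType) n (u : 'rV[R]_n) : sqnorm u = \sum_k u 0 k ^+ 2.
Proof. by rewrite /sqnorm mxE; apply: eq_bigr => k _; rewrite mxE expr2. Qed.

Lemma sqnorm_ge0 (R : rcfType) n (u : 'rV[R]_n) : 0 <= sqnorm u.
Proof. by rewrite sqnormE sumr_ge0 // => k _; rewrite sqr_ge0. Qed.

Lemma sqnorm_eq0 (R : rcfType) n (u : 'rV[R]_n) : (sqnorm u == 0) = (u == 0).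
Proof.
rewrite sqnormE psumr_eq0 => [|k _]; last exact: sqr_ge0.
apply/idP/eqP => [/allP u0|->]; last by apply/allP => k _ /=; rewrite mxE expr0n.
apply/rowP => k; rewrite mxE; apply/eqP.
by have := u0 k (mem_index_enum k); rewrite /= sqrf_eq0.
Qed.

Lemma sqnorm_gt0 (R : rcfType) n (u : 'rV[R]_n) : (0 < sqnorm u) = (u != 0).
Proof. by rewrite lt0r sqnorm_eq0 sqnorm_ge0 andbT. Qed.

Lemma qform1 (R : rcfType) n (u : 'rV[R]_n) : qform 1%:M u = sqnorm u.
Proof. by rewrite /qform mulmx1. Qed.

Lemma qformD (R : rcfType) n (X Y : 'M[R]_n) u :
  qform (X + Y) u = qform X u + qform Y u.
Proof. by rewrite /qform mulmxDr mulmxDl mxE. Qed.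

Lemma qformZ (R : rcfType) n a (X : 'M[R]_n) u : qform (a *: X) u = a * qform X u.
Proof. by rewrite /qform -scalemxAr -scalemxAl mxE. Qed.

Lemma qform_congruence (R : rcfType) m n (B : 'M[R]_(m, n)) (V : 'M_m) u :
  qform (B^T *m V *m B) u = qform V (u *m B^T).
Proof. by rewrite /qform trmx_mul trmxK !mulmxA. Qed.

(** * The spectral theorem for real symmetric matrices *)

(** The characteristic polynomial has a complex root [z], with an eigenvector
    [v].  As [X] is real and symmetric, [v X v^*] equals both [z |v|^2] and its
    conjugate, so [z] is real and already an eigenvalue over the base field. *)
Lemma symmetric_eigenvector (R : rcfType) n (X : 'M[R]_n.+1) :
  X^T = X -> exists a, exists2 v : 'rV_n.+1, v *m X = a *: v & sqnorm v = 1.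
Proof.
move=> X_sym; set XC := map_mx (real_complex R) X.
have [z z_eig] : exists z, eigenvalue XC z by apply: eigenvalue_closed.
have [v vX v0] := eigenvalueP z_eig.
set v' := (map_mx Num.conj v)^T.
have Xv' : XC *m v' = z^* *: v'.
  have XC_conj : map_mx Num.conj XC = XC.
    by apply/matrixP => i j; rewrite !mxE; apply/CrealP/complex_realP; exists (X i j).
  have XC_sym : XC^T = XC by rewrite /XC map_trmx X_sym.
  by rewrite /v' -{1}XC_sym -trmx_mul -{1}XC_conj -map_mxM vX map_mxZ linearZ.
have vv'_neq0 : (v *m v') 0 0 != 0.
  apply: contraNneq v0 => /eqP; rewrite mxE psumr_eq0 => [/allP vv0|k _].
    apply/eqP/rowP => k; apply/eqP; have := vv0 k (mem_index_enum k).
    by rewrite !mxE /= -normCK sqrf_eq0 normr_eq0.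
  by rewrite !mxE -normCK exprn_ge0.
have : z *: (v *m v') = z^* *: (v *m v').
  by rewrite scalemxAl -vX -mulmxA Xv' -scalemxAr.
move/matrixP/(_ 0 0); rewrite [LHS]mxE [RHS]mxE => zz.
have /complex_realP[a za] : z \is Num.real.
  exact/CrealP/esym/(mulIf vv'_neq0).
have : eigenvalue X a.
  by rewrite -(eigenvalue_map (real_complex R)) -/XC -[X in eigenvalue _ X]za.
case/eigenvalueP => u uX u0; exists a, ((Num.sqrt (sqnorm u))^-1 *: u).
  by rewrite -scalemxAl uX !scalerA mulrC.
rewrite /sqnorm -scalemxAl linearZ /= -scalemxAr scalerA mxE -/(sqnorm u).
by rewrite -invfM -expr2 sqr_sqrtr ?sqnorm_ge0 // mulVf // sqnorm_eq0.
Qed.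

(** The Householder reflection in the hyperplane orthogonal to [v - e], where [e]
    is the first basis vector, exchanges [e] and the unit vector [v].  It
    extends [v] to an orthonormal basis without a Gram-Schmidt process. *)
Lemma unit_row_of_reflection (R : rcfType) n (v : 'rV[R]_n.+1) :
  sqnorm v = 1 ->
  exists2 H : 'M[R]_n.+1, H^T = H & H *m H = 1%:M /\ row 0 H = v.
Proof.
move=> v1; set e : 'rV[R]_n.+1 := delta_mx 0 0; set u := v - e.
have rowe (H : 'M_n.+1) : row 0 H = e *m H by rewrite -rowE.
have [->|v_neq] := eqVneq v e.
  by exists 1%:M; rewrite ?trmx1 // mulmx1 rowe mulmx1.
have u0 : sqnorm u != 0 by rewrite sqnorm_eq0 subr_eq0.
have ueE : e *m u^T = (v 0 0 - 1)%:M.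
  by rewrite -rowE [LHS]mx11_scalar !mxE !eqxx.
have uu : u *m u^T = (sqnorm u)%:M by rewrite [LHS]mx11_scalar.
have uuE : sqnorm u = - 2 * (v 0 0 - 1).
  have vvE : v *m v^T = 1%:M by rewrite [LHS]mx11_scalar -/(sqnorm v) v1.
  have ve : v *m e^T = (v 0 0)%:M.
    by rewrite -[v *m _]trmxK trmx_mul trmxK -rowE [LHS]mx11_scalar !mxE.
  rewrite /sqnorm {1}/u mulmxBl ueE /u linearB /= mulmxBr vvE ve.
  by rewrite !mxE /=; ring.
have uEE : (u^T *m u) *m (u^T *m u) = sqnorm u *: (u^T *m u).
  by rewrite mulmxA -(mulmxA u^T u) uu mul_mx_scalar -scalemxAl.
have ve : v = e + u by rewrite addrC subrK.
have v0 : v 0 0 - 1 != 0.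
  by apply: contraNneq u0 => v0; rewrite uuE v0 mulr0.
clearbody u; set E := u^T *m u in uEE *; set c := 2 / sqnorm u.
exists (1%:M - c *: E).
  by rewrite linearB linearZ /= trmx1 trmx_mul trmxK.
split.
  have cc : c * c * sqnorm u = c + c by rewrite /c; field.
  rewrite mulmxBl mul1mx mulmxBr mulmx1 -scalemxAl -scalemxAr uEE !scalerA cc.
  by rewrite scalerDl opprB addrK subrK.
rewrite rowe mulmxBr mulmx1 -scalemxAr mulmxA ueE mul_scalar_mx scalerA /c uuE ve.
rewrite [_ / _ * _](_ : _ = -1) ?scaleN1r ?opprK //.
by rewrite -ve; field.
Qed.

(** Induction on the size: conjugating by a reflection whose first row is a unit
    eigenvector makes the first row, hence by symmetry the first column, of the
    matrix vanish off the diagonal; the rest is the induction hypothesis. *)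
Theorem symmetric_spectral (R : rcfType) n (X : 'M[R]_n) :
  X^T = X -> exists2 P : 'M[R]_n, P *m P^T = 1%:M &
               exists d : 'rV_n, X = P^T *m diag_mx d *m P.
Proof.
elim: n X => [|n IHn] X X_sym.
  exists 1%:M; first by rewrite trmx1 mulmx1.
  by exists 0; apply/matrixP => -[][].
have [a [v vX /unit_row_of_reflection[H H_sym [HH rowH]]]] := symmetric_eigenvector X_sym.
set Y : 'M_(1 + n) := H *m X *m H.
have Y_sym : Y^T = Y by rewrite /Y !trmx_mul H_sym X_sym mulmxA.
have Y_row j : Y 0 j = a * (0 == j)%:R.
  have -> : Y 0 j = row 0 Y 0 j by rewrite [RHS]mxE.
  rewrite /Y -mulmxA row_mul rowH mulmxA vX -scalemxAl -rowH -row_mul HH.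
  by rewrite !mxE.
have XY : X = H *m Y *m H by rewrite /Y !mulmxA HH mul1mx -mulmxA HH mulmx1.
clearbody Y.
have lshift0 : lshift n (0 : 'I_1) = 0 by apply: val_inj.
have Y_block : Y = block_mx a%:M 0 0 (drsubmx Y).
  rewrite -[LHS]submxK; congr block_mx.
  - by rewrite [LHS]mx11_scalar !mxE lshift0 Y_row eqxx mulr1.
  - by apply/rowP => j; rewrite !mxE lshift0 Y_row mulr0.
  - by apply/colP => j; rewrite -Y_sym !mxE lshift0 Y_row mulr0.
have [|P PP [d Pd]] := IHn (drsubmx Y).
  by rewrite trmx_drsub Y_sym.
pose B : 'M[R]_(1 + n) := block_mx 1%:M 0 0 P.
have BB : B *m B^T = 1%:M.
  rewrite tr_block_mx mulmx_block !trmx0 trmx1 !mulmx0 !mul0mx mul1mx PP.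
  by rewrite !addr0 add0r -scalar_mx_block.
have BdB : B^T *m diag_mx (row_mx a%:M d) *m B = Y.
  have -> : diag_mx (row_mx a%:M d) = block_mx a%:M 0 0 (diag_mx d).
    by rewrite diag_mx_row; congr block_mx; apply/matrixP => i j; rewrite !ord1 !mxE.
  rewrite Y_block Pd tr_block_mx !mulmx_block !trmx0 trmx1.
  by rewrite !mulmx0 !mul0mx mul1mx mulmx1 !addr0 !add0r !mul0mx.
exists (B *m H).
  by rewrite trmx_mul H_sym mulmxA -(mulmxA B H H) HH mulmx1 BB.
exists (row_mx a%:M d).
by rewrite [LHS]XY -BdB trmx_mul H_sym !mulmxA.
Qed.

(** * Eigenvalues of an orthogonally diagonalized matrix *)

Lemma count_ge_nth (R : rcfType) (s : seq R) i : sorted >=%R s ->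
  (i < size s)%N -> (i < count (fun x => s`_i <= x)%R s)%N.
Proof.
move=> s_sorted lti; rewrite -{2}(cat_take_drop i.+1 s) count_cat.
apply: leq_trans (leq_addr _ _).
rewrite (_ : count _ _ = i.+1) // -[RHS](size_takel lti); apply/eqP; rewrite -all_count.
apply/(all_nthP 0) => j; rewrite size_takel // ltnS => leji; rewrite nth_take //.
apply: (sorted_leq_nth ge_trans ge_refl _ s_sorted) => //.
by rewrite inE (leq_ltn_trans leji).
Qed.

Lemma count_le_nth (R : rcfType) (s : seq R) i : sorted >=%R s ->
  (size s <= i + count (fun x => x <= s`_i)%R s)%N.
Proof.
move=> s_sorted; rewrite -{3}(cat_take_drop i s) count_cat -leq_subLR.
apply: leq_trans (leq_addl _ _); rewrite -size_drop.
rewrite leq_eqVlt eq_sym -all_count; apply/orP; left.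
apply/(all_nthP 0) => j; rewrite size_drop ltn_subRL => ltj; rewrite nth_drop.
apply: (sorted_leq_nth ge_trans ge_refl _ s_sorted) => //; last exact: leq_addr.
by rewrite inE (leq_ltn_trans _ ltj) ?leq_addr.
Qed.

Section Spectral.
Context (R : rcfType) (n : nat) (X P : 'M[R]_n) (d : 'rV[R]_n).
Hypotheses (PP : P *m P^T = 1%:M) (XE : X = P^T *m diag_mx d *m P).

Lemma eigenvals_spectral :
  eigenvals X = sort >=%R [seq d 0 k | k <- enum 'I_n].
Proof.
have ge_total : total (>=%R : rel R) by move=> x y; apply: le_total.
apply: eigenvals_split; last exact: sort_sorted.
rewrite (perm_big _ (permEl (perm_sort _ _))) big_map big_enum /=.
have PtP : P^T *m P = 1%:M by apply: mulmx1C.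
pose PX := map_mx polyC P.
have PXE : map_mx polyC P^T *m PX = 1%:M by rewrite -map_mxM PtP map_mx1.
have -> : char_poly X = char_poly (diag_mx d).
  rewrite /char_poly.
  have -> : char_poly_mx X = map_mx polyC P^T *m char_poly_mx (diag_mx d) *m PX.
    rewrite /char_poly_mx mulmxBr mulmxBl XE !map_mxM scalar_mxC.
    by rewrite -(mulmxA 'X%:M _ PX) PXE mulmx1.
  by rewrite !det_mulmx mulrAC -det_mulmx PXE det1 mul1r.
rewrite char_poly_trig; last by apply: diag_mx_is_trig.
by apply: eq_bigr => k _; rewrite mxE eqxx.
Qed.

(** Counting diagonal entries by value avoids reordering the eigenbasis: the two
    eigenspaces below are spanned by the basis vectors whose diagonal entries
    compare suitably with [lambda i X]. *)
Lemma card_spectral (p : pred R) :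
  #|[set k | p (d 0 k)]| = count p (eigenvals X).
Proof.
rewrite eigenvals_spectral (permP (permEl (perm_sort _ _))).
rewrite -sum1_count big_map big_enum_cond /= -sum1_card.
by apply: eq_bigl => k; rewrite inE.
Qed.

Lemma eigenvals_sorted : sorted >=%R (eigenvals X).
Proof. by rewrite eigenvals_spectral sort_sorted // => x y; apply: le_total. Qed.

Lemma size_eigenvals : size (eigenvals X) = n.
Proof. by rewrite eigenvals_spectral size_sort size_map -cardE card_ord. Qed.

Lemma qform_spectral u : qform X u = \sum_k d 0 k * (u *m P^T) 0 k ^+ 2.
Proof.
rewrite /qform XE !mulmxA -(mulmxA _ P) -[P *m _]trmxK trmx_mul trmxK mxE.
apply: eq_bigr => k _.
by rewrite mul_mx_diag [X in X * _]mxE [X in _ * X]mxE; ring.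
Qed.

Lemma sqnorm_spectral u : sqnorm u = \sum_k (u *m P^T) 0 k ^+ 2.
Proof.
rewrite -sqnormE /sqnorm trmx_mul trmxK mulmxA -(mulmxA u).
by rewrite (mulmx1C PP) mulmx1.
Qed.

(** The witness is spanned by the rows of [P] indexed by [S]; they are
    orthonormal, and [u *m P^T] lists the coordinates of [u] on the rows of [P]. *)
Lemma spectral_subspace (S : {set 'I_n}) :
  exists2 U : 'M[R]_n, \rank U = #|S| &
    forall u : 'rV_n, (u <= U)%MS -> forall k, k \notin S -> (u *m P^T) 0 k = 0.
Proof.
pose V := rowsub (enum_val : 'I_#|S| -> 'I_n) P; exists (<<V>>%MS).
  rewrite mxrank_gen; apply/eqP/row_freeP; exists V^T.
  rewrite /V trmx_mxsub -mxsub_mul PP; apply/matrixP => i j.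
  by rewrite !mxE (inj_eq enum_val_inj).
move=> u; rewrite genmxE => /submxP[a ->] k kS.
rewrite -mulmxA mul_rowsub_mx PP mxE big1 // => j _; rewrite !mxE.
by case: eqP => [jk|_]; rewrite ?mulr0 //; rewrite -jk enum_valP in kS.
Qed.

End Spectral.

(** * The Courant-Fischer principle *)

Lemma top_eigenspace (R : rcfType) n (X : 'M[R]_n) i :
  X^T = X -> (0 < i <= n)%N ->
  exists2 U : 'M[R]_n, (i <= \rank U)%N &
    forall u : 'rV_n, (u <= U)%MS -> lambda i X * sqnorm u <= qform X u.
Proof.
move=> /symmetric_spectral[P PP [d XE]] /andP[i_gt0 le_in].
have [U rankU U0] := spectral_subspace PP [set k | lambda i X <= d 0 k].
exists U => [|u uU].
  rewrite rankU (card_spectral PP XE) /lambda -[i in (i <= _)%N]prednK //.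
  apply: count_ge_nth; first exact: eigenvals_sorted PP XE.
  by rewrite (size_eigenvals PP XE) prednK.
rewrite (sqnorm_spectral PP) (qform_spectral XE) mulr_sumr ler_sum // => k _.
have [kS|/U0->//] := boolP (k \in [set k | lambda i X <= d 0 k]).
  by rewrite inE in kS; rewrite ler_wpM2r // sqr_ge0.
by rewrite expr0n !mulr0.
Qed.

(** For [i > n], where [lambda i X] is [0], the zero subspace qualifies: the
    dimension bound and the inequality then hold trivially.  This keeps indices
    beyond the size of [W^2] from being a special case. *)
Lemma bottom_eigenspace (R : rcfType) n (X : 'M[R]_n) i :
  X^T = X -> (0 < i)%N ->
  exists2 U : 'M[R]_n, (n < i + \rank U)%N &
    forall u : 'rV_n, (u <= U)%MS -> qform X u <= lambda i X * sqnorm u.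
Proof.
move=> /symmetric_spectral[P PP [d XE]] i_gt0.
have [U rankU U0] := spectral_subspace PP [set k | d 0 k <= lambda i X].
exists U => [|u uU].
  rewrite rankU (card_spectral PP XE (fun x => x <= _)) /lambda.
  rewrite -[i in (i + _)%N]prednK // addSn ltnS -{1}(size_eigenvals PP XE).
  exact/count_le_nth/(eigenvals_sorted PP XE).
rewrite (sqnorm_spectral PP) (qform_spectral XE) mulr_sumr ler_sum // => k _.
have [kS|/U0->//] := boolP (k \in [set k | d 0 k <= lambda i X]).
  by rewrite inE in kS; rewrite ler_wpM2r // sqr_ge0.
by rewrite expr0n !mulr0.
Qed.

Lemma cap_nonzero (F : fieldType) m1 m2 n (U : 'M[F]_(m1, n)) (V : 'M_(m2, n)) :
  (n < \rank U + \rank V)%N ->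
  exists2 u : 'rV_n, u != 0 & (u <= U)%MS && (u <= V)%MS.
Proof.
rewrite -mxrank_sum_cap => n_lt.
have /rowV0Pn[u] : (U :&: V)%MS != 0.
  rewrite -mxrank_eq0 -lt0n -(ltn_add2l (\rank (U + V))) addn0.
  exact: leq_ltn_trans (rank_leq_col _) n_lt.
by rewrite sub_capmx => uUV u0; exists u.
Qed.

(** [U] meets the bottom eigenspace of index [i] in a nonzero vector, at which
    the quotient of the form by the squared norm is squeezed between [c] and
    [lambda i X]. *)
Lemma lambda_ge (R : rcfType) n (X : 'M[R]_n) i m (U : 'M_(m, n)) c :
  X^T = X -> (0 < i <= \rank U)%N ->
  (forall u : 'rV_n, (u <= U)%MS -> c * sqnorm u <= qform X u) ->
  c <= lambda i X.
Proof.
move=> X_sym /andP[i_gt0 le_iU] U_ge.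
have [V rankV V_le] := bottom_eigenspace X_sym i_gt0.
have [|u u0 /andP[uU uV]] := @cap_nonzero _ _ _ _ U V.
  by rewrite (leq_trans rankV) ?leq_add2r.
rewrite -(ler_pM2r (_ : 0 < sqnorm u)) ?sqnorm_gt0 //.
exact: le_trans (U_ge u uU) (V_le u uV).
Qed.

Lemma lambda_le (R : rcfType) n (X : 'M[R]_n) i m (U : 'M_(m, n)) c :
  X^T = X -> (0 < i <= n)%N -> (n < i + \rank U)%N ->
  (forall u : 'rV_n, (u <= U)%MS -> qform X u <= c * sqnorm u) ->
  lambda i X <= c.
Proof.
move=> X_sym le_in n_lt U_le.
have [V rankV V_ge] := top_eigenspace X_sym le_in.
have [|u u0 /andP[uU uV]] := @cap_nonzero _ _ _ _ U V.
  by rewrite (leq_trans n_lt) // addnC leq_add2l.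
rewrite -(ler_pM2r (_ : 0 < sqnorm u)) ?sqnorm_gt0 //.
exact: le_trans (V_ge u uV) (U_le u uU).
Qed.

Lemma qform_ge_min (R : rcfType) n (X : 'M[R]_n) (u : 'rV_n) :
  X^T = X -> lambda n X * sqnorm u <= qform X u.
Proof.
case: n X u => [|n] X u X_sym.
  by rewrite /qform /sqnorm !mxE !big_ord0 mulr0.
have [|U rankU U_ge] := @top_eigenspace _ _ X n.+1 X_sym; first exact: leqnn.
by apply: U_ge; rewrite submx_full // /row_full eqn_leq rank_leq_col.
Qed.

Lemma qform_le_max (R : rcfType) n (X : 'M[R]_n) (u : 'rV_n) :
  X^T = X -> qform X u <= lambda 1 X * sqnorm u.
Proof.
move=> X_sym; have [U rankU U_le] := @bottom_eigenspace _ _ X 1 X_sym isT.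
by apply: U_le; rewrite submx_full // /row_full eqn_leq rank_leq_col.
Qed.

(** * Eigenvalues of positive semidefinite matrices *)

Definition psd (R : rcfType) n (X : 'M[R]_n) : Prop :=
  X^T = X /\ forall u, 0 <= qform X u.

Lemma lambda_overflow (R : rcfType) n (X : 'M[R]_n) i :
  X^T = X -> (n < i)%N -> lambda i X = 0.
Proof.
move=> /symmetric_spectral[P PP [d XE]] lt_ni; rewrite /lambda nth_default //.
by rewrite (size_eigenvals PP XE) -ltnS (ltn_predK lt_ni).
Qed.

Lemma lambda_ge0 (R : rcfType) n (X : 'M[R]_n) i :
  psd X -> (0 < i)%N -> 0 <= lambda i X.
Proof.
move=> [X_sym X_ge0] i_gt0.
have [le_in|lt_ni] := leqP i n; last by rewrite lambda_overflow.
apply: (@lambda_ge _ _ _ _ _ 1%:M) => // [|u _]; last by rewrite mul0r.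
by rewrite mxrank1 i_gt0.
Qed.

(** Positivity covers the indices [j] beyond the size, where [lambda j X] is [0]. *)
Lemma lambda_antitone (R : rcfType) n (X : 'M[R]_n) i j :
  psd X -> (0 < i <= j)%N -> lambda j X <= lambda i X.
Proof.
move=> X_psd /andP[i_gt0 le_ij]; have [X_sym _] := X_psd.
have [le_jn|lt_nj] := leqP j n; last by rewrite (lambda_overflow X_sym lt_nj) lambda_ge0.
have [|U rankU U_ge] := @top_eigenspace _ _ X j X_sym.
  by rewrite le_jn (leq_trans i_gt0).
by apply: lambda_ge U_ge; rewrite // i_gt0 (leq_trans le_ij).
Qed.

Lemma gram_psd (R : rcfType) m n (B : 'M[R]_(m, n)) : psd (B^T *m B).
Proof.
split=> [|u]; first by rewrite trmx_mul trmxK.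
by rewrite -[B^T]mulmx1 qform_congruence qform1 sqnorm_ge0.
Qed.

(** * Congruences *)

(** The preimage of [U] under [C] is the kernel of [C] followed by the cokernel
    of [U], so lying in it imposes at most [m - \rank U] linear conditions on the
    vectors of [E]. *)
Lemma preimage_subspace (F : fieldType) p m n (E : 'M[F]_(p, n))
    (C : 'M[F]_(n, m)) (U : 'M[F]_m) :
  exists2 W : 'M[F]_n, (\rank E + \rank U <= m + \rank W)%N &
    forall u : 'rV_n, (u <= W)%MS -> (u <= E)%MS && (u *m C <= U)%MS.
Proof.
exists (E :&: kermx (C *m cokermx U))%MS => [|u].
  rewrite -(mxrank_mul_ker E (C *m cokermx U)) addnAC leq_add2r.
  rewrite -[leqRHS](subnK (rank_leq_col U)) leq_add2r -mxrank_coker mulmxA.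
  exact: mxrankM_maxr.
by rewrite sub_capmx sub_kermx mulmxA -submxE.
Qed.

Section Congruence.
Context (R : rcfType) (m n : nat) (B : 'M[R]_(m, n)) (V : 'M[R]_m).
Hypothesis V_psd : psd V.

Let sqnorm_gram u : sqnorm (u *m B^T) = qform (B^T *m B) u.
Proof. by rewrite -[B^T in RHS]mulmx1 qform_congruence qform1. Qed.

(** The top eigenspace of [V] of index [i + (m - r)] has codimension at most
    [r - i], so pulling it back by [B] cuts an [r]-dimensional top eigenspace of
    [B^T B] down to dimension at least [i]; on what is left both lower bounds
    multiply, because [lambda (i + (m - r)) V] is nonnegative. *)
Lemma congruence_top (r i : nat) : (r <= m)%N -> (r <= n)%N -> (0 < i <= r)%N ->
  exists2 U : 'M[R]_n, (i <= \rank U)%N &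
    forall u, (u <= U)%MS ->
      lambda r (B^T *m B) * lambda (i + (m - r)) V * sqnorm u
        <= qform (B^T *m V *m B) u.
Proof.
move=> le_rm le_rn /andP[i_gt0 le_ir]; have [V_sym V_ge0] := V_psd.
have [B_sym _] := gram_psd B; have r_gt0 := leq_trans i_gt0 le_ir.
have [|E rankE E_ge] := @top_eigenspace _ _ _ r B_sym; first by rewrite r_gt0.
have [|U rankU U_ge] := @top_eigenspace _ _ _ (i + (m - r)) V_sym.
  by rewrite addn_gt0 i_gt0 addnBA // leq_subLR leq_add2r.
have [W rankW W_sub] := preimage_subspace E B^T U.
exists W => [|u /W_sub/andP[uE uU]].
  rewrite -(leq_add2l m); apply: leq_trans rankW.
  apply: leq_trans (leq_add rankE rankU).
  by rewrite addnCA subnKC // addnC.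
rewrite qform_congruence; apply: le_trans (U_ge _ uU); rewrite mulrAC mulrC.
rewrite ler_wpM2l ?lambda_ge0 ?addn_gt0 ?i_gt0 // sqnorm_gram.
exact: E_ge.
Qed.

Lemma congruence_bottom i : (0 < i)%N ->
  exists2 U : 'M[R]_n, (n < i + \rank U)%N &
    forall u, (u <= U)%MS ->
      qform (B^T *m V *m B) u <= lambda 1 (B^T *m B) * lambda i V * sqnorm u.
Proof.
move=> i_gt0; have [V_sym V_ge0] := V_psd; have [B_sym _] := gram_psd B.
have [U rankU U_le] := @bottom_eigenspace _ _ _ i V_sym i_gt0.
have [W rankW W_sub] := preimage_subspace (1%:M : 'M_n) B^T U.
exists W => [|u /W_sub/andP[_ uU]].
  rewrite mxrank1 in rankW.
  by rewrite -(ltn_add2r (\rank U)) (leq_ltn_trans rankW) // addnAC ltn_add2r.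
rewrite qform_congruence; apply: le_trans (U_le _ uU) _; rewrite mulrAC mulrC.
rewrite ler_wpM2r ?lambda_ge0 // sqnorm_gram.
exact: qform_le_max.
Qed.

End Congruence.

(** * Eigenvalue bounds for the normal-equations matrix *)

Theorem theorem4p2 (R : realType) (M N K : nat) (A : 'M[R]_(M, N))
    (Psi : 'M[R]_(K, N)) (mu : R) (w : 'rV[R]_K) :
  0 < mu -> (forall k : 'I_K, 0 < w 0 k) ->
  let W := diag_mx w in
  let Q := Qst A Psi mu w in
  let r := \rank Psi in
  (forall i : nat, (1 <= i <= r)%N ->
    [/\ lambda N (A^T *m A)
          + mu * lambda r (Psi^T *m Psi) * lambda (i + (K - r)) (W *m W)
          <= lambda i Q,
        (K <= N)%N ->
        lambda N (A^T *m A)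
          + mu * lambda r (Psi^T *m Psi) * lambda (i + (N - r)) (W *m W)
          <= lambda i Q
      & lambda i Q <=
        lambda 1 (A^T *m A)
          + mu * lambda 1 (Psi^T *m Psi) * lambda i (W *m W)]) /\
  (forall i : nat, (r < i <= N)%N ->
    lambda N (A^T *m A) <= lambda i Q
    /\ lambda i Q <=
       lambda 1 (A^T *m A)
         + mu * lambda 1 (Psi^T *m Psi) * lambda i (W *m W)).
Proof.
move=> mu_gt0 _ W Q r; have mu_ge0 := ltW mu_gt0.
have [AA_sym _] := gram_psd A; have PP_psd := gram_psd Psi.
have W_psd : psd (W *m W) by rewrite -{1}[W]tr_diag_mx; apply: gram_psd.
have [W_sym W_ge0] := W_psd.
have Q_sym : Q^T = Q.
  rewrite /Q /Qst linearD linearZ /= AA_sym trmx_mul (trmx_mul Psi^T) trmxK.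
  by rewrite W_sym mulmxA.
have QE u : qform Q u
    = qform (A^T *m A) u + mu * qform (Psi^T *m (W *m W) *m Psi) u.
  by rewrite qformD qformZ.
have Q_le i : (0 < i <= N)%N -> lambda i Q <=
    lambda 1 (A^T *m A) + mu * lambda 1 (Psi^T *m Psi) * lambda i (W *m W).
  move=> i_le; have /andP[i_gt0 _] := i_le.
  have [U rankU U_le] := congruence_bottom Psi W_psd i_gt0.
  apply: lambda_le rankU _ => // u uU.
  rewrite QE mulrDl lerD ?qform_le_max // -!mulrA ler_wpM2l // mulrA.
  exact: U_le.
have Q_ge i : (0 < i <= r)%N -> lambda N (A^T *m A)
    + mu * lambda r (Psi^T *m Psi) * lambda (i + (K - r)) (W *m W) <= lambda i Q.
  move=> i_le; have /andP[i_gt0 _] := i_le.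
  have [U rankU U_ge] :=
    congruence_top Psi W_psd (rank_leq_row Psi) (rank_leq_col Psi) i_le.
  apply: (@lambda_ge _ _ _ _ _ U) => // [|u uU]; first by rewrite i_gt0.
  rewrite QE mulrDl lerD ?qform_ge_min // -!mulrA ler_wpM2l // mulrA.
  exact: U_ge.
split=> i /andP[i_ge i_le].
  have i_gt0 : (0 < i <= r)%N by rewrite i_ge.
  split; [exact: Q_ge | | ]; last first.
    by rewrite Q_le // i_ge (leq_trans i_le) ?rank_leq_col.
  move=> le_KN; apply: le_trans (Q_ge i i_gt0); rewrite lerD2l ler_wpM2l //.
    by rewrite mulr_ge0 // lambda_ge0 // (leq_trans i_ge).
  by rewrite lambda_antitone // addn_gt0 i_ge leq_add2l leq_sub2r.
have i_gt0 : (0 < i)%N by apply: leq_ltn_trans i_ge.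
split; last by rewrite Q_le // i_gt0.
apply: (@lambda_ge _ _ _ _ _ 1%:M) => // [|u _]; first by rewrite mxrank1 i_gt0.
rewrite QE -[leLHS]addr0 lerD ?qform_ge_min // mulr_ge0 // qform_congruence.
exact: W_ge0.
Qed.
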